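(* Let $\Gamma$ be a respectful tree with $n$ leaves, equipped with its faithful interval marking $\mu_{<}$ with respect to the usual order $<$ on $\overline{n}=\{1,\dots,n\}$. Then the set $L^{\Gamma}=\{\alpha_M\mid \emptyset\ne M\subseteq\overline{n}\}$ is an $\mathscr{L}$-cross-section of $\mathcal{O}_n$. Conversely, every $\mathscr{L}$-cross-section of $\mathcal{O}_n$ equals $L^{\Gamma}$ for some respectful tree $\Gamma$ with $n$ leaves and faithful interval marking $\mu_{<}$.
   Context: $\mathcal{O}_n$ is the monoid of all order-preserving transformations of $\overline{n}=\{1,\dots,n\}$ (naturally ordered; maps act on the right). In $\mathcal{O}_n$, $\alpha\mathscr{L}\beta$ iff $\mathrm{im}(\alpha)=\mathrm{im}(\beta)$. An $\mathscr{L}$-cross-section of $\mathcal{O}_n$ is a subsemigroup containing exactly one element of each $\mathscr{L}$-class. **Trees.** All trees are rooted binary trees: each vertex $v$ has at most one left child (its son $\mathbf{s}(v)$, a male vertex) and at most one right child (its daughter $\mathbf{d}(v)$, a female vertex). A tree is full if every non-leaf has exactly two children. A homomorphism of trees is an injective map of vertex sets sending root to root and preserving the parent–child relation and the genders of non-root vertices. A vertex $u$ subordinates a vertex $v$ of the same tree if there is a homomorphism from the subtree rooted at $u$ to the subtree rooted at $v$. A full binary tree is respectful if (S1) whenever a male vertex $v$ has a nephew (a son of the sister of $v$), the nephew subordinates $v$; and (S2) whenever a female vertex $v$ has a niece (a daughter of the brother of $v$), the niece subordinates $v$. **Marking.** The faithful interval marking $\mu_<$ of a full binary tree $\Gamma$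 with $n$ leaves assigns to each vertex an interval of $\overline{n}$: the size of the interval assigned to $v$ is the number of leaves of the subtree rooted at $v$ (so the root gets $[1,n]$), and if $v$ gets $[p,q]$ with $p<q$, then the son of $v$ gets $[p,t]$ and the daughter gets $[t+1,q]$ for some $p\le t<q$. It is unique; vertices are identified with their intervals. **The transformations $\alpha_M$.** For non-empty $M\subseteq\overline{n}$ let $\langle M\rangle$ be the intersection of all vertices (intervals) of $\Gamma$ containing $M$. For a vertex $A$ of $\Gamma$ or $A=\emptyset$, and $B=\langle M\rangle$, define the partial map $\alpha^A_M$ inductively: (a) if $A=\emptyset$, $\alpha^A_M$ is the empty map; (b) if $M=\{m\}$ and $A\ne\emptyset$, then $\alpha^A_M$ has domain $A$ and sends every element of $A$ to $m$; (c) if $|M|>1$ and $A\neq\emptyset$, then $\alpha^A_M=\alpha^{\mathbf{s}(A)}_{M\cap\mathbf{s}(B)}\cup\alpha^{\mathbf{d}(A)}_{M\cap\mathbf{d}(B)}$ (union of maps with disjoint domains). Put $\alpha_M=\alpha^{\overline{n}}_M$. *)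

(* Defs.v *)
From HB Require Import structures.
From mathcomp Require Import all_boot.
From mathcomp Require Import zify.

Set Implicit Arguments.
Unset Strict Implicit.
Unset Printing Implicit Defensive.

Local Open Scope group_scope.

(* Throughout, the chain {1, ..., n} is represented by 'I_n = {0, ..., n - 1}. *)

(* Equality of the principal left ideals S a and S b; a monoid S contains 1,
   so no identity has to be adjoined. *)
Definition green_L (S : monoidType) (a b : S) : Prop :=
  (exists x, a = x * b) /\ (exists y, b = y * a).

(* Non-emptiness of the subsemigroup C follows from the second clause. *)
Definition L_cross_section (S : monoidType) (C : {pred S}) : Prop :=
  {in C &, forall a b, a * b \in C} /\
  (forall a : S, exists! c : S, c \in C /\ green_L c a).

Definition order_preserving n (f : {ffun 'I_n -> 'I_n}) : bool :=
  [forall x : 'I_n, forall y : 'I_n, (x <= y) ==> (f x <= f y)].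

Record On (n : nat) := MkOn {
  On_val :> {ffun 'I_n -> 'I_n};
  _ : order_preserving On_val }.

HB.instance Definition _ n := [isSub for @On_val n].
HB.instance Definition _ n := [Finite of On n by <:].

Section OnMonoid.
Variable n : nat.
Implicit Types a b c : On n.

Lemma order_preservingP (f : {ffun 'I_n -> 'I_n}) :
  reflect (forall x y : 'I_n, x <= y -> f x <= f y) (order_preserving f).
Proof.
apply: (iffP forallP) => [Hf x y xy | Hf x].
  by move/forallP: (Hf x) => /(_ y) /implyP; apply.
by apply/forallP => y; apply/implyP; apply: Hf.
Qed.

Lemma On_mono a (x y : 'I_n) : x <= y -> a x <= a y.
Proof. by move: x y; apply/order_preservingP; case: a. Qed.

(* Maps act on the right: a product applies its left factor first. *)
Lemma On_mul_subproof a b : order_preserving [ffun x => b (a x)].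
Proof. by apply/order_preservingP => x y xy; rewrite !ffunE !On_mono. Qed.
Definition On_mul a b : On n := MkOn (On_mul_subproof a b).

Lemma On_one_subproof : order_preserving [ffun x : 'I_n => x].
Proof. by apply/order_preservingP => x y xy; rewrite !ffunE. Qed.
Definition On_one : On n := MkOn On_one_subproof.

Lemma On_mulA : associative On_mul.
Proof. by move=> a b c; apply/val_inj/ffunP => x; rewrite !ffunE. Qed.
Lemma On_mul1 : left_id On_one On_mul.
Proof. by move=> a; apply/val_inj/ffunP => x; rewrite !ffunE. Qed.
Lemma On_mul1r : right_id On_one On_mul.
Proof. by move=> a; apply/val_inj/ffunP => x; rewrite !ffunE. Qed.

HB.instance Definition _ := isMonoid.Build (On n) On_mulA On_mul1 On_mul1r.

Lemma On_mulE a b x : (a * b) x = b (a x).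
Proof. by rewrite ffunE. Qed.

Lemma On_left_divisor a b :
  [set a x | x : 'I_n] \subset [set b x | x : 'I_n] -> exists c, a = c * b.
Proof.
move=> sab.
have ex (x : 'I_n) : exists y, b y == a x.
  have /(subsetP sab) /imsetP[y _ ->] : a x \in [set a x | x : 'I_n].
    exact: imset_f.
  by exists y.
pose g x := [arg min_(y < xchoose (ex x) | b y == a x) (y : nat)].
have gP x : b (g x) = a x /\ forall y, b y = a x -> g x <= y.
  rewrite /g; case: arg_minnP => [|y /eqP by_ ymin]; first exact: (xchooseP (ex x)).
  by split=> // z /eqP; apply: ymin.
have gmono : order_preserving [ffun x => g x].
  apply/order_preservingP => x y xy; rewrite !ffunE leqNgt; apply/negP => lt.
  have [bx minx] := gP x; have [b_y miny] := gP y.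
  have ab : a x = a y.
    apply/val_inj/eqP; rewrite eqn_leq (On_mono a xy) /=.
    by rewrite -b_y -bx (On_mono b (ltnW lt)).
  have := minx (g y); rewrite b_y ab => /(_ erefl); lia.
exists (MkOn gmono); apply/val_inj/ffunP => x.
by rewrite [RHS]On_mulE ffunE; case: (gP x).
Qed.

Lemma green_L_On a b :
  green_L a b <-> [set a x | x : 'I_n] = [set b x | x : 'I_n].
Proof.
split=> [[[c ac] [d bd]] | eqab].
  apply/eqP; rewrite eqEsubset; apply/andP; split; apply/subsetP => y.
    by case/imsetP => x _ ->; rewrite ac On_mulE imset_f.
  by case/imsetP => x _ ->; rewrite bd On_mulE imset_f.
by split; apply: On_left_divisor; rewrite eqab.
Qed.

End OnMonoid.

Definition ptrans n := {ffun 'I_n -> option 'I_n}.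

Definition ptrans0 n : ptrans n := [ffun=> None].

Definition ptrans_cst n (A : {set 'I_n}) (m : 'I_n) : ptrans n :=
  [ffun x => if x \in A then Some m else None].

Definition ptrans_union n (f g : ptrans n) : ptrans n :=
  [ffun x => if f x is Some y then Some y else g x].

Definition ptrans_of n (a : On n) : ptrans n := [ffun x => Some (a x)].

(* A set X of partial maps consists of elements of O_n, and these form an
   L-cross-section of O_n. *)
Definition is_L_cross_section_On n (X : {set ptrans n}) : Prop :=
  exists2 C : {set On n},
    L_cross_section C & X = [set ptrans_of a | a in C].

(* [Node l r] has the subtree l at the son and r at the daughter of its root. *)
Inductive fbtree := Leaf | Node of fbtree & fbtree.

(* A vertex is the sequence of genders on the path leading to it from the root,
   with [male] and [female] standing for a son and a daughter respectively. *)
Definition vertex := seq bool.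
Notation male := false (only parsing).
Notation female := true (only parsing).

Definition son (v : vertex) : vertex := rcons v male.
Definition daughter (v : vertex) : vertex := rcons v female.

Fixpoint leaves (t : fbtree) : nat :=
  if t is Node l r then leaves l + leaves r else 1.

Fixpoint vertices (t : fbtree) : seq vertex :=
  [::] :: (if t is Node l r
           then map (cons male) (vertices l) ++ map (cons female) (vertices r)
           else [::]).

(* Meaningful only when v is a vertex of t. *)
Fixpoint subtree (t : fbtree) (v : vertex) : fbtree :=
  match v, t with
  | g :: v', Node l r => subtree (if g == male then l else r) v'
  | _, _ => t
  end.

Definition tree_hom (t u : fbtree) (f : vertex -> vertex) : Prop :=
  [/\ {in vertices t, forall v, f v \in vertices u},
      {in vertices t &, injective f},
      f [::] = [::],
      (forall v, son v \in vertices t -> f (son v) = son (f v)) &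
      (forall v, daughter v \in vertices t ->
         f (daughter v) = daughter (f v))].

Definition subordinates (t : fbtree) (u v : vertex) : Prop :=
  exists f, tree_hom (subtree t u) (subtree t v) f.

(* Every male vertex is [son p] for a unique p; its sister is [daughter p] and
   its nephew is [son (daughter p)]. Dually for female vertices. *)
Definition respectful (t : fbtree) : Prop :=
  (forall p, son (daughter p) \in vertices t ->
     subordinates t (son (daughter p)) (son p)) /\
  (forall p, daughter (son p) \in vertices t ->
     subordinates t (daughter (son p)) (daughter p)).

Definition segment n (p q : nat) : {set 'I_n} := [set i : 'I_n | p <= i <= q].

(* The defining properties of the marking; by [markP] and [mark_unique] below,
   they determine [mark n t] on the vertices of t. *)
Definition faithful_marking n (t : fbtree) (mu : vertex -> {set 'I_n}) : Prop :=
  mu [::] = segment n 0 n.-1 /\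
  forall v, v \in vertices t -> exists p q,
    [/\ p <= q, q < n, mu v = segment n p q,
        (q - p).+1 = leaves (subtree t v) &
        p < q -> exists s, [/\ p <= s, s < q,
          mu (son v) = segment n p s & mu (daughter v) = segment n s.+1 q]].

(* The marking of t when its leaves are numbered lo, lo + 1, ...; sequences
   that are not vertices of t are sent to the empty set. *)
Fixpoint mark_from n (t : fbtree) (lo : nat) (v : vertex) : {set 'I_n} :=
  match v, t with
  | [::], _ => segment n lo (lo + leaves t).-1
  | g :: v', Node l r =>
      if g == male then mark_from n l lo v'
      else mark_from n r (lo + leaves l) v'
  | _ :: _, Leaf => set0
  end.

Definition mark n (t : fbtree) (v : vertex) : {set 'I_n} := mark_from n t 0 v.

Section Alpha.
Variables (n : nat) (G : fbtree).
Implicit Types A B M : {set 'I_n}.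

Definition hull M : {set 'I_n} :=
  \bigcap_(v <- vertices G | M \subset mark n G v) mark n G v.

(* Vertices are identified with their intervals; the child of a leaf, or of a
   set that is not a vertex (such as set0), is set0. *)
Definition set_child (child : vertex -> vertex) A : {set 'I_n} :=
  if [seq v <- vertices G | mark n G v == A] is v :: _
  then mark n G (child v) else set0.

Definition set_son := set_child son.
Definition set_daughter := set_child daughter.

(* k bounds the cardinal of A; see [alphaE] for the resulting equation. *)
Fixpoint alpha_rec (k : nat) A M : ptrans n :=
  if k isn't k'.+1 then ptrans0 n
  else if A == set0 then ptrans0 n
  else if [pick m | M == [set m]] is Some m then ptrans_cst A m
  else ptrans_union
         (alpha_rec k' (set_son A) (M :&: set_son (hull M)))
         (alpha_rec k' (set_daughter A) (M :&: set_daughter (hull M))).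

Definition alpha A M : ptrans n := alpha_rec #|A| A M.

Definition L_of_tree : {set ptrans n} :=
  [set alpha setT M | M : {set 'I_n} & M != set0].

End Alpha.

Lemma leaves_gt0 t : 0 < leaves t.
Proof. by elim: t => //= l IHl r IHr; rewrite addn_gt0 IHl. Qed.

Lemma root_in_vertices t : [::] \in vertices t.
Proof. by case: t. Qed.

Lemma in_vertices_cons l r g v :
  (g :: v \in vertices (Node l r)) =
  (v \in vertices (if g == male then l else r)).
Proof.
rewrite /= inE /= mem_cat.
have inj b : injective (cons b : vertex -> vertex) by move=> ? ? [].
have no b c (s : seq vertex) : b != c -> (b :: v \in map (cons c) s) = false.
  by move=> bc; apply/negP => /mapP[w _ [/eqP]]; rewrite (negPf bc).
by case: g; rewrite ?mem_map // no // ?orbF.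
Qed.

Lemma mark_from_spec n t lo v : lo + leaves t <= n -> v \in vertices t ->
  exists p q, [/\ lo <= p <= q, q < lo + leaves t,
    mark_from n t lo v = segment n p q,
    (q - p).+1 = leaves (subtree t v) &
    if subtree t v is Node _ _ then
      exists s, [/\ p <= s, s < q,
        mark_from n t lo (son v) = segment n p s &
        mark_from n t lo (daughter v) = segment n s.+1 q]
    else mark_from n t lo (son v) = set0 /\
         mark_from n t lo (daughter v) = set0].
Proof.
elim: t lo v => [|l IHl r IHr] lo [|g v] //= le_n.
- by move=> _; exists lo, lo; split; rewrite ?addn1 //=; lia.
- move=> _; have := leaves_gt0 l; have := leaves_gt0 r => r0 l0.
  exists lo, (lo + (leaves l + leaves r)).-1; split; [lia|lia|by []|lia|].
  exists (lo + leaves l).-1; split; [lia|lia| by case: (l)|].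
  by rewrite prednK ?addnA; [case: (r)|lia].
rewrite (in_vertices_cons l r); case: g => /= vin.
- have [|p [q [p1 p2 p3 p4 p5]]] := IHr (lo + leaves l) v _ vin; first by lia.
  by exists p, q; split=> //; lia.
- have [|p [q [p1 p2 p3 p4 p5]]] := IHl lo v _ vin; first by lia.
  by exists p, q; split=> //; lia.
Qed.

Lemma markP n t : leaves t = n -> faithful_marking t (mark n t).
Proof.
move=> tn; split; first by rewrite /mark; case: t tn => [|l r] /= <-.
move=> v vin; have [|p [q [p1 p2 p3 p4 p5]]] := @mark_from_spec n t 0 v _ vin.
  by rewrite tn.
have p12 : p <= q by case/andP: p1.
have qn : q < n by rewrite -tn.
exists p, q; split=> // pq.
by case: (subtree t v) p4 p5 => [|l r] //=; lia.
Qed.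

Lemma vertices_rcons t v g : rcons v g \in vertices t ->
  [/\ v \in vertices t, son v \in vertices t, daughter v \in vertices t &
      leaves (subtree t v) =
      leaves (subtree t (son v)) + leaves (subtree t (daughter v))].
Proof.
elim: t v => [|l IHl r IHr] v; first by case: v => [|b v]; rewrite /= inE.
case: v => [|b v]; rewrite ?rcons_cons.
  move=> _; split; [exact: root_in_vertices | | |].
  - by rewrite -[son _]/[:: male] in_vertices_cons root_in_vertices.
  - by rewrite -[daughter _]/[:: female] in_vertices_cons root_in_vertices.
  - by rewrite /=; case: (l); case: (r).
rewrite -[son _]/(b :: son v) -[daughter _]/(b :: daughter v).
rewrite !in_vertices_cons.
by case: b => [/IHr | /IHl].
Qed.

Lemma card_segment n p q : q < n -> p <= q ->
  #|segment n p q| = (q - p).+1.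
Proof.
move=> qn pq.
have lt (k : 'I_(q - p).+1) : p + k < n by have := ltn_ord k; lia.
rewrite -[RHS]card_ord -[RHS]cardsT.
have inj : injective (fun k => Ordinal (lt k)).
  by move=> k k' /(congr1 val) /= /addnI /val_inj.
rewrite -(card_imset _ inj); apply: eq_card => i; rewrite inE.
apply/idP/imsetP => [/andP[pi iq] | [k _ ->] /=]; last by have := ltn_ord k; lia.
have ltk : i - p < (q - p).+1 by lia.
by exists (Ordinal ltk) => //; apply: val_inj => /=; lia.
Qed.

Lemma segment_inj n p q p' q' : p <= q -> q < n -> p' <= q' -> q' < n ->
  segment n p q = segment n p' q' -> p = p' /\ q = q'.
Proof.
move=> pq qn pq' qn' /setP E.
have pn : p < n by lia. have pn' : p' < n by lia.
have := E (Ordinal pn); have := E (Ordinal pn').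
have := E (Ordinal qn); have := E (Ordinal qn'); rewrite !inE /=; lia.
Qed.

Lemma mark_unique n t mu : leaves t = n -> faithful_marking t mu ->
  {in vertices t, mu =1 mark n t}.
Proof.
move=> tn [mu0 mu_] v; have [nu0 nu_] := markP tn.
elim/last_ind: v => [|v g IH] vin; first by rewrite mu0 nu0.
have [vt st dt El] := vertices_rcons vin.
have := leaves_gt0 (subtree t (son v)).
have := leaves_gt0 (subtree t (daughter v)) => d0 s0.
have [p [q [pq qn Ev sz]]] := mu_ _ vt.
have [p' [q' [pq' qn' Ev' sz']]] := nu_ _ vt.
have [Ep Eq] : p = p' /\ q = q'.
  by apply: (@segment_inj n) => //; rewrite -Ev -Ev' IH.
subst p' q'.
case; first by lia.
move=> s' [ps' sq' Es' Ed']; case; first by lia.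
move=> s [ps sq Es Ed].
have szof (nu : vertex -> {set 'I_n}) w : faithful_marking t nu -> w \in vertices t ->
    #|nu w| = leaves (subtree t w).
  by move=> [_ H] /H[a [b [ab bn -> <- _]]]; apply: card_segment.
have := szof mu _ (conj mu0 mu_) st.
have := szof (mark n t) _ (conj nu0 nu_) st.
rewrite Es Es' !card_segment //; try lia.
move=> e1 e2; have ss : s = s' by lia.
by case: g {vin}; rewrite -/(son _) -/(daughter _) ?Ed ?Ed' ?Es ?Es' ss.
Qed.

Lemma set_child_proper n t c (A : {set 'I_n}) :
  leaves t = n -> c = son \/ c = daughter -> A != set0 ->
  #|set_child t c A| < #|A|.
Proof.
move=> tn cE An0; rewrite /set_child.
case E: [seq _ <- _ | _] => [|v s]; first by rewrite cards0 card_gt0.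
have : v \in [seq v <- vertices t | mark n t v == A] by rewrite E mem_head.
rewrite mem_filter => /andP[/eqP <- vin].
have [|p [q [/andP[_ pq] qn Ev _]]] := @mark_from_spec n t 0 v _ vin.
  by rewrite tn.
have {}qn : q < n by lia.
rewrite [mark n t v]Ev card_segment //.
case: (subtree t v) => [[Es Ed] | _ _ [m [pm mq Es Ed]]];
  case: cE => ->; rewrite /mark ?Es ?Ed ?cards0 // card_segment //; lia.
Qed.

(* The defining recursion, free of the bound k; [pick] succeeds exactly when M
   is a singleton {m}. *)
Lemma alphaE n t (A M : {set 'I_n}) : leaves t = n ->
  alpha t A M =
    if A == set0 then ptrans0 n
    else if [pick m | M == [set m]] is Some m then ptrans_cst A m
    else ptrans_union
           (alpha t (set_son t A) (M :&: set_son t (hull t M)))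
           (alpha t (set_daughter t A) (M :&: set_daughter t (hull t M))).
Proof.
move=> tn.
have stable k k' (B N : {set 'I_n}) : #|B| <= k -> #|B| <= k' ->
    alpha_rec t k B N = alpha_rec t k' B N.
  elim: k k' B N => [|k IH] [|k'] B N //=.
  - by rewrite leqn0 cards_eq0 => /eqP->; rewrite eqxx.
  - by move=> _; rewrite leqn0 cards_eq0 => ->.
  move=> Bk Bk'; case: ifPn => // Bn0; case: pickP => // _.
  have := set_child_proper tn (or_introl erefl) Bn0.
  have := set_child_proper tn (or_intror erefl) Bn0.
  move=> ltd lts.
  by congr ptrans_union; apply: IH; rewrite -ltnS;
    do [exact: leq_trans lts _ | exact: leq_trans ltd _].
case: ifPn => [/eqP-> | An0]; first by rewrite /alpha cards0.
have := set_child_proper tn (or_introl erefl) An0.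
have := set_child_proper tn (or_intror erefl) An0.
rewrite {1}/alpha; case: #|A| => [|k] //= ltd lts.
rewrite (negPf An0); case: pickP => // _.
by congr ptrans_union; apply: stable => //; rewrite -ltnS;
  do [exact: leq_trans lts _ | exact: leq_trans ltd _].
Qed.

(* Main.v *)
(* Call a map between the leaf intervals of two trees good if, down to a constant
   map, it sends the son and the daughter of its domain to the son and the daughter
   of the hull of its image. The good maps from the root to the root are the total
   maps among the alpha_M, such a map is determined by its image, and the good maps
   are closed under composition. In a respectful tree every subtree embeds into the
   tree itself, so that every alpha_M is total.

   Conversely, let C be an L-cross-section. If e in C maps [p, q] onto {p, q} and
   fixes the complement, then f e = e for every f in C that fixes the complement and
   meets both fibres of e in [p, q]: such f therefore preserves the cut of [p, q] made
   by e. Cutting recursively yields a tree whose intervals can all be collapsed inside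
   C. Composing f in C with these collapses, and using again that elements of C are
   determined by their images, shows that f is good. That C has an element with image
   any given set then forces the tree to be respectful. *)

Require Import Defs.
From mathcomp Require Import all_boot.
From mathcomp Require Import zify.

Set Implicit Arguments.
Unset Strict Implicit.
Unset Printing Implicit Defensive.

Local Open Scope group_scope.

(** * Embeddings of trees and a recursive form of respectfulness *)

(** Decidable form of the existence of a tree homomorphism; see [tree_hom_embeds]. *)
Fixpoint embeds (t u : fbtree) : bool :=
  match t, u with
  | Leaf, _ => true
  | Node _ _, Leaf => false
  | Node l r, Node l' r' => embeds l l' && embeds r r'
  end.

Lemma embeds_refl t : embeds t t.
Proof. by elim: t => //= l -> r ->. Qed.

Lemma embeds_trans u t w : embeds t u -> embeds u w -> embeds t w.
Proof.
elim: t u w => [|l IHl r IHr] [|ul ur] [|wl wr] //= /andP[tl tr] /andP[ul_ ur_].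
by rewrite (IHl ul) // (IHr ur).
Qed.

Lemma embedsP t u :
  reflect {subset vertices t <= vertices u} (embeds t u).
Proof.
apply: (iffP idP).
  elim: t u => [|l IHl r IHr] u.
    by move=> _ v; rewrite inE => /eqP->; apply: root_in_vertices.
  case: u => [|ul ur] // /andP[El Er] [|[] v]; first by rewrite !root_in_vertices.
    by rewrite !in_vertices_cons; apply: IHr.
  by rewrite !in_vertices_cons; apply: IHl.
elim: t u => [|l IHl r IHr] u // sub.
case: u sub => [|ul ur] sub.
  by have := sub [:: false]; rewrite in_vertices_cons root_in_vertices => /(_ isT).
apply/andP; split; [apply: IHl|apply: IHr] => v Hv.
  by have := sub (false :: v); rewrite !in_vertices_cons; apply.
by have := sub (true :: v); rewrite !in_vertices_cons; apply.
Qed.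

(** A vertex is its path of genders, and a homomorphism preserves the root and the genders, so by
    induction along the path it fixes every vertex. *)
Lemma tree_hom_embeds t u : (exists f, tree_hom t u f) <-> embeds t u.
Proof.
split=> [[f [fV _ f0 fs fd]] | /embedsP sub]; last by exists id; split.
suff fid v : v \in vertices t -> f v = v by apply/embedsP => v vt; rewrite -(fid v vt) fV.
elim/last_ind: v => // v g IH vin; have [vt st dt _] := vertices_rcons vin.
by case: g {vin}; rewrite -?/(son v) -?/(daughter v) ?fs ?fd // IH.
Qed.

(** For a node [l], [embeds l t] asks that the son of [l] embed in [l], which [self_similar l]
    already gives, and that the daughter of [l] embed in [r], which is (S2) at the root of [t].
    Dually, [embeds r t] encodes (S1). *)
Fixpoint self_similar (t : fbtree) : bool :=
  if t is Node l r then
    [&& self_similar l, self_similar r, embeds l t & embeds r t]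
  else true.

Lemma self_similar_respectful t : self_similar t -> respectful t.
Proof.
elim: t => [|l IHl r IHr]; first by split=> -[|g p].
move=> /and4P[/IHl[l1 l2] /IHr[r1 r2] El Er].
have snE g (p : vertex) b : rcons (g :: p) b = g :: rcons p b by [].
split=> -[|g p].
- rewrite /subordinates tree_hom_embeds /= => _.
  by case: r Er {IHr r1 r2 El} => [|rl rr] //= /andP[] ; case: (l); case: (rl).
- rewrite /subordinates /son /daughter !snE in_vertices_cons /=.
  by case: g => /=; [apply: r1 | apply: l1].
- rewrite /subordinates tree_hom_embeds /= => _.
  by case: l El {IHl l1 l2 Er} => [|ll lr] //= /andP[_]; case: (r); case: (lr).
- rewrite /subordinates /son /daughter !snE in_vertices_cons /=.
  by case: g => /=; [apply: r2 | apply: l2].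
Qed.

Lemma subtree0 t : subtree t [::] = t.
Proof. by case: t. Qed.

Lemma respectful_self_similar t : respectful t -> self_similar t.
Proof.
elim: t => [|l IHl r IHr] // [H1 H2].
have snE g (p : vertex) b : rcons (g :: p) b = g :: rcons p b by [].
have sl : self_similar l.
  apply: IHl; split=> p pin.
    by have := H1 (false :: p); rewrite /subordinates /son /daughter !snE
      in_vertices_cons; apply.
  by have := H2 (false :: p); rewrite /subordinates /son /daughter !snE
      in_vertices_cons; apply.
have sr : self_similar r.
  apply: IHr; split=> p pin.
    by have := H1 (true :: p); rewrite /subordinates /son /daughter !snE
      in_vertices_cons; apply.
  by have := H2 (true :: p); rewrite /subordinates /son /daughter !snE
      in_vertices_cons; apply.
rewrite /= sl sr /=; apply/andP; split.
  case: l H2 sl {IHl IHr H1} => [|ll lr] // H2 /and4P[_ _ ll_l _].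
  have := H2 [::]; rewrite /subordinates tree_hom_embeds !in_vertices_cons /=.
  by rewrite root_in_vertices !subtree0 ll_l => ->.
case: r H1 sr {IHl IHr H2} => [|rl rr] // H1 /and4P[_ _ _ rr_r].
have := H1 [::]; rewrite /subordinates tree_hom_embeds !in_vertices_cons /=.
by rewrite root_in_vertices !subtree0 rr_r => -> //.
Qed.

(** * Good maps between leaf intervals *)

Section Good.
Variable n : nat.
Implicit Types (f g : 'I_n -> 'I_n) (t u w : fbtree) (lo : nat) (M : {set 'I_n}).

Definition block t lo : {set 'I_n} := [set x : 'I_n | lo <= x < lo + leaves t].

Lemma block_node l r lo :
  block (Node l r) lo = block l lo :|: block r (lo + leaves l).
Proof. by apply/setP => x; rewrite !inE /=; lia. Qed.

Lemma block_neq0 t lo : lo + leaves t <= n -> block t lo != set0.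
Proof.
move=> le_n; have t0 := leaves_gt0 t.
have lt : lo < n by lia.
by apply/set0Pn; exists (Ordinal lt); rewrite inE /=; lia.
Qed.

(* [good f t lo u lo'] says that f maps [block t lo] to [block u lo'] in the way
   that rules (b) and (c) prescribe; [good_left] and [good_right] descend to the
   hull of the image. *)
Inductive good f : fbtree -> nat -> fbtree -> nat -> Prop :=
| good_leaf t lo lo' :
    {in block t lo, forall x, f x = lo' :> nat} -> good f t lo Leaf lo'
| good_left t lo ul ur lo' :
    good f t lo ul lo' -> good f t lo (Node ul ur) lo'
| good_right t lo ul ur lo' :
    good f t lo ur (lo' + leaves ul) -> good f t lo (Node ul ur) lo'
| good_split tl tr lo ul ur lo' :
    good f tl lo ul lo' -> good f tr (lo + leaves tl) ur (lo' + leaves ul) ->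
    good f (Node tl tr) lo (Node ul ur) lo'.

Lemma good_leaf_inv f t lo lo' : good f t lo Leaf lo' ->
  {in block t lo, forall x, f x = lo' :> nat}.
Proof. by move E: Leaf => u gf; case: gf E. Qed.

Lemma good_node_inv f t lo ul ur lo' : good f t lo (Node ul ur) lo' ->
  [\/ good f t lo ul lo', good f t lo ur (lo' + leaves ul) |
      exists tl tr, [/\ t = Node tl tr, good f tl lo ul lo' &
        good f tr (lo + leaves tl) ur (lo' + leaves ul)]].
Proof.
by move=> gf; inversion gf; subst; [apply: Or31 | apply: Or32 | apply: Or33; do 2 eexists].
Qed.

Lemma good_range f t lo u lo' :
  good f t lo u lo' -> {in block t lo, forall x, f x \in block u lo'}.
Proof.
elim=> {t lo u lo'} [t lo lo' fE x /fE E | t lo ul ur lo' _ IH x /IH |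
  t lo ul ur lo' _ IH x /IH | tl tr lo ul ur lo' _ IHl _ IHr x].
- by rewrite inE E /=; lia.
- by rewrite !inE /=; lia.
- by rewrite !inE /=; lia.
- by rewrite block_node inE => /orP[/IHl | /IHr]; rewrite !inE /=; lia.
Qed.

Lemma good_mono f t lo u lo' : good f t lo u lo' ->
  {in block t lo &, forall x y : 'I_n, x <= y -> f x <= f y}.
Proof.
elim=> {t lo u lo'} [t lo lo' fE x y /fE Ex /fE Ey| t lo ul ur lo' _ IH x |
  t lo ul ur lo' _ IH x | tl tr lo ul ur lo' gl IHl gr IHr x y].
- by rewrite Ex Ey.
- exact: IH.
- exact: IH.
rewrite block_node 2!in_setU => /orP[xl|xr] /orP[yl|yr] xy.
- exact: IHl.
- by have := good_range gl xl; have := good_range gr yr; rewrite !inE; lia.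
- by move: xr yl; rewrite !inE; lia.
- exact: IHr.
Qed.

Lemma eq_good f g t lo u lo' : {in block t lo, f =1 g} ->
  good f t lo u lo' -> good g t lo u lo'.
Proof.
move=> fg gf; elim: gf fg => {t lo u lo'} [t lo lo' fE fg | t lo ul ur lo' _ IH fg |
  t lo ul ur lo' _ IH fg | tl tr lo ul ur lo' _ IHl _ IHr].
- by apply: good_leaf => x xt; rewrite -fg // fE.
- exact/good_left/IH.
- exact/good_right/IH.
rewrite block_node => fg; apply: good_split; [apply: IHl|apply: IHr] => x xt;
  by apply: fg; rewrite inE xt ?orbT.
Qed.

(** Serves composition: when the first map lands under one child of the middle tree, the second map
    is restricted to that child. *)
Lemma good_restrict f l r lo u lo' : good f (Node l r) lo u lo' ->
  good f l lo u lo' /\ good f r (lo + leaves l) u lo'.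
Proof.
elim: u lo' => [|ul IHl ur IHr] lo'.
  move/good_leaf_inv; rewrite block_node => fE.
  by split; apply: good_leaf => x xt; apply: fE; rewrite inE xt ?orbT.
case/good_node_inv => [/IHl[gl gr] | /IHr[gl gr] | [_ [_ [[<- <-] gl gr]]]].
- by split; apply: good_left.
- by split; apply: good_right.
- by split; [apply: good_left | apply: good_right].
Qed.

(** Induction on the derivation for [f]: a constant map stays constant, a descent in [u] restricts
    [g] to a child, and a split is matched against the derivation for [g]. *)
Lemma good_comp f g t lo u lo' w lo'' :
  good f t lo u lo' -> good g u lo' w lo'' -> good (g \o f) t lo w lo''.
Proof.
move=> gf; elim: gf w lo'' => {t lo u lo'} [t lo lo' fE | t lo ul ur lo' _ IH |
  t lo ul ur lo' _ IH | tl tr lo ul ur lo' gfl IHl gfr IHr] w lo''.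
- elim: w lo'' => [|wl IHl wr IHr] lo''.
    move/good_leaf_inv => gE; apply: good_leaf => x xt /=; apply: gE.
    by rewrite inE fE //=; lia.
  by case/good_node_inv => [/IHl | /IHr | [? [? [] //]]];
    [apply: good_left | apply: good_right].
- by case/good_restrict => gl _; apply: IH.
- by case/good_restrict => _ gr; apply: IH.
elim: w lo'' => [|wl IHwl wr IHwr] lo''.
  move/good_leaf_inv => gE; apply: good_leaf => x xt /=; apply: gE.
  exact: (good_range (good_split gfl gfr)).
case/good_node_inv => [/IHwl | /IHwr | [_ [_ [[<- <-] gl gr]]]].
- exact: good_left.
- exact: good_right.
- by apply: good_split; [apply: IHl | apply: IHr].
Qed.

(** A surjection cannot descend to one child, since the block of the other is non-empty. It
    therefore splits at every node of [u], and [t] has a node there too. *)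
Lemma good_onto_embeds f t lo u lo' : lo' + leaves u <= n ->
  good f t lo u lo' -> f @: block t lo = block u lo' -> embeds u t.
Proof.
move=> le_n gf; elim: gf le_n => {t lo u lo'} [//| t lo ul ur lo' gf _ |
  t lo ul ur lo' gf _ | tl tr lo ul ur lo' gl IHl gr IHr] /= le_n onto.
- have [y yr] : exists y, y \in block ur (lo' + leaves ul).
    by apply/set0Pn/block_neq0; lia.
  have : y \in f @: block t lo by rewrite onto block_node inE yr orbT.
  by case/imsetP => x /(good_range gf) + E; move: yr; rewrite E !inE; lia.
- have [y yl] : exists y, y \in block ul lo'.
    by apply/set0Pn/block_neq0; lia.
  have : y \in f @: block t lo by rewrite onto block_node inE yl.
  by case/imsetP => x /(good_range gf) + E; move: yl; rewrite E !inE; lia.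
have [ltl ltr] := (leaves_gt0 ul, leaves_gt0 ur).
move: onto; rewrite !block_node imsetU => onto.
have subl := good_range gl; have subr := good_range gr.
apply/andP; split; [apply: IHl|apply: IHr]; try lia.
  apply/eqP; rewrite eqEsubset; apply/andP; split; apply/subsetP => y.
    by case/imsetP => x xt ->; apply: subl.
  move=> yl; have : y \in block ul lo' :|: block ur (lo' + leaves ul) by rewrite inE yl.
  rewrite -onto inE => /orP[//|/imsetP[x /subr + E]].
  by move: yl; rewrite E !inE; lia.
apply/eqP; rewrite eqEsubset; apply/andP; split; apply/subsetP => y.
  by case/imsetP => x xt ->; apply: subr.
move=> yl; have : y \in block ul lo' :|: block ur (lo' + leaves ul) by rewrite inE yl orbT.
rewrite -onto inE => /orP[/imsetP[x /subl + E]|//].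
by move: yl; rewrite E !inE; lia.
Qed.

(** Induction on [u] with [t] arbitrary. If [M] lies under one child of [u], that child still embeds
    in [t] by self-similarity, and the domain stays whole. Otherwise [M] meets both child blocks and
    both trees split. *)
Lemma good_exists t lo u lo' M : self_similar u -> embeds u t ->
  lo + leaves t <= n -> M != set0 -> M \subset block u lo' ->
  exists2 f, good f t lo u lo' & f @: block t lo = M.
Proof.
elim: u t lo lo' M => [|ul IHl ur IHr] t lo lo' M.
  move=> _ _ le_n /set0Pn[m mM] /subsetP sub.
  have E y : y \in M -> y = m.
    move=> yM; apply/val_inj; have := sub _ yM; have := sub _ mM.
    by rewrite !inE /=; lia.
  exists (fun=> m).
    by apply: good_leaf => x _; have := sub _ mM; rewrite inE /=; lia.
  apply/setP => y; apply/imsetP/idP => [[x _ ->] // | /E ->].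
  by have /set0Pn[x xt] := block_neq0 le_n; exists x.
case: t => [|tl tr] // /and4P[ssl ssr elu eru] etu le_n M0 sub.
have [subl | nsubl] := boolP (M \subset block ul lo').
  have [f gf fM] := IHl _ lo lo' M ssl (embeds_trans elu etu) le_n M0 subl.
  by exists f => //; apply: good_left.
have [subr | nsubr] := boolP (M \subset block ur (lo' + leaves ul)).
  have [f gf fM] := IHr _ lo _ M ssr (embeds_trans eru etu) le_n M0 subr.
  by exists f => //; apply: good_right.
case/andP: etu => etl etr; rewrite /= in le_n.
have [f1 gf1 f1M] : exists2 f, good f tl lo ul lo' & f @: block tl lo = M :&: block ul lo'.
  apply: IHl; rewrite ?subsetIr //; first by clear -le_n; lia.
  have /subsetPn[y yM yr] := nsubr; apply/set0Pn; exists y.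
  by rewrite inE yM; have := subsetP sub _ yM; rewrite block_node inE (negPf yr) orbF.
have [f2 gf2 f2M] : exists2 f, good f tr (lo + leaves tl) ur (lo' + leaves ul) &
    f @: block tr (lo + leaves tl) = M :&: block ur (lo' + leaves ul).
  apply: IHr; rewrite ?subsetIr //; first by clear -le_n; lia.
  have /subsetPn[y yM yr] := nsubl; apply/set0Pn; exists y.
  by rewrite inE yM; have := subsetP sub _ yM; rewrite block_node inE (negPf yr).
pose f (x : 'I_n) := if x < lo + leaves tl then f1 x else f2 x.
have E1 : {in block tl lo, f1 =1 f}.
  by move=> x; rewrite inE /f => /andP[_ ->].
have E2 : {in block tr (lo + leaves tl), f2 =1 f}.
  by move=> x; rewrite inE /f => /andP[le _]; rewrite ltnNge le.
exists f.
  by apply: good_split; [apply: eq_good E1 gf1 | apply: eq_good E2 gf2].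
rewrite block_node imsetU -(eq_in_imset E1) -(eq_in_imset E2) f1M f2M -setIUr.
by rewrite -block_node; apply/setIidPl.
Qed.

(* Adding a point of the sister block to M forces the good map with image M
   to split at the root, and hence to restrict to the child. *)
Lemma full_self_similar t lo : lo + leaves t <= n ->
  (forall M, M != set0 -> M \subset block t lo ->
     exists2 f, good f t lo t lo & f @: block t lo = M) ->
  self_similar t.
Proof.
elim: t lo => [|l IHl r IHr] lo //= le_n full.
have [l0 r0] := (leaves_gt0 l, leaves_gt0 r).
have /set0Pn[x xl] : block l lo != set0 by apply: block_neq0; lia.
have /set0Pn[y yr] : block r (lo + leaves l) != set0 by apply: block_neq0; lia.
have disj z : z \in block l lo -> z \in block r (lo + leaves l) -> False.
  by rewrite !inE; lia.
have disjl (M : {set 'I_n}) : M \subset block l lo -> M :&: block r (lo + leaves l) = set0.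
  move=> /subsetP s; apply/setP => z; rewrite !inE.
  by apply/negP => /andP[/s zl zr]; apply: (disj z); rewrite // inE.
have disjr (M : {set 'I_n}) : M \subset block r (lo + leaves l) -> M :&: block l lo = set0.
  move=> /subsetP s; apply/setP => z; rewrite !inE.
  by apply/negP => /andP[/s zl zr]; apply: (disj z); rewrite // inE.
have imsub g s o s' o' : good g s o s' o' -> g @: block s o \subset block s' o'.
  by move=> gg; apply/subsetP => z /imsetP[z' /(good_range gg) + ->].
apply/and4P; split.
- apply: (IHl lo) => [|M M0 sub]; first by lia.
  have [||f gf fM] := full (M :|: [set y]).
  + by apply/set0Pn; exists y; rewrite !inE eqxx orbT.
  + by rewrite block_node setUSS // sub1set.
  have yM : y \in M :|: [set y] by rewrite !inE eqxx orbT.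
  have [z zM] := set0Pn _ M0.
  have zM' : z \in M :|: [set y] by rewrite inE zM.
  have zl := subsetP sub z zM.
  rewrite -fM in yM zM'.
  case: (good_node_inv gf) => [gd | gd | [_ [_ [[<- <-] gl gr]]]].
  + by case: (disj y) => //; apply: (subsetP (imsub _ _ _ _ _ gd)).
  + by case: (disj z) => //; apply: (subsetP (imsub _ _ _ _ _ gd)).
  exists f => //; move/(congr1 (fun A => A :&: block l lo)): fM.
  rewrite block_node imsetU !setIUl (disjr _ (imsub _ _ _ _ _ gr)) setU0.
  rewrite (disjr [set y]) ?sub1set // setU0.
  by rewrite (setIidPl (imsub _ _ _ _ _ gl)) (setIidPl sub).
- apply: (IHr (lo + leaves l)) => [|M M0 sub]; first by lia.
  have [||f gf fM] := full ([set x] :|: M).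
  + by apply/set0Pn; exists x; rewrite !inE eqxx.
  + by rewrite block_node setUSS // sub1set.
  have xM : x \in [set x] :|: M by rewrite !inE eqxx.
  have [z zM] := set0Pn _ M0.
  have zM' : z \in [set x] :|: M by rewrite inE zM orbT.
  have zl := subsetP sub z zM.
  rewrite -fM in xM zM'.
  case: (good_node_inv gf) => [gd | gd | [_ [_ [[<- <-] gl gr]]]].
  + by case: (disj z) => //; apply: (subsetP (imsub _ _ _ _ _ gd)).
  + by case: (disj x) => //; apply: (subsetP (imsub _ _ _ _ _ gd)).
  exists f => //; move/(congr1 (fun A => A :&: block r (lo + leaves l))): fM.
  rewrite block_node imsetU !setIUl (disjl _ (imsub _ _ _ _ _ gl)) set0U.
  rewrite (disjl [set x]) ?sub1set // set0U.
  by rewrite (setIidPl (imsub _ _ _ _ _ gr)) (setIidPl sub).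
(* When the image is the block of the son, a split would send the daughter outside it. The map thus
   descends to the son and is onto it, which gives the embedding. *)
- have [||f gf fM] := full (block l lo).
  + by apply: block_neq0; lia.
  + by rewrite block_node subsetUl.
  have xM := xl; rewrite -fM in xM.
  case: (good_node_inv gf) => [gd | gd | [_ [_ [[<- <-] gl gr]]]].
  + by apply: (good_onto_embeds _ gd fM); lia.
  + by case: (disj x) => //; apply: (subsetP (imsub _ _ _ _ _ gd)).
  have : f y \in f @: block (Node l r) lo by rewrite imset_f // block_node inE yr orbT.
  by rewrite fM => /disj; case; apply: (good_range gr).
- have [||f gf fM] := full (block r (lo + leaves l)).
  + by apply: block_neq0; lia.
  + by rewrite block_node subsetUr.
  have yM := yr; rewrite -fM in yM.
  case: (good_node_inv gf) => [gd | gd | [_ [_ [[<- <-] gl gr]]]].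
  + by case: (disj y) => //; apply: (subsetP (imsub _ _ _ _ _ gd)).
  + by apply: (good_onto_embeds _ gd fM); lia.
  have : f x \in f @: block (Node l r) lo by rewrite imset_f // block_node inE xl.
  by rewrite fM => /(disj (f x)); case; apply: (good_range gl).
Qed.

End Good.

Lemma imset_setT (aT rT : finType) (f : aT -> rT) :
  f @: [set: aT] = [set f x | x : aT].
Proof. by apply/setP => y; apply/imsetP/imsetP => -[x _ ->]; exists x. Qed.

(** * Paths and intervals of the marking *)

Lemma vertices_cat t v w : v \in vertices t ->
  (v ++ w \in vertices t) = (w \in vertices (subtree t v)).
Proof.
elim: v t => [|g v IH] [|l r] //.
by rewrite cat_cons !in_vertices_cons; apply: IH.
Qed.

Lemma subtree_cat t v w : v \in vertices t ->
  subtree t (v ++ w) = subtree (subtree t v) w.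
Proof.
by elim: v t => [|g v IH] [|l r] //; rewrite in_vertices_cons; apply: IH.
Qed.

Section Mark.
Variable n : nat.
Implicit Types (t : fbtree) (lo : nat) (v w : vertex) (M : {set 'I_n}).

Lemma mark_from_root t lo : mark_from n t lo [::] = block n t lo.
Proof.
have t0 := leaves_gt0 t.
by apply/setP => x; case: t t0 => [|l r] /= t0; rewrite !inE /=; lia.
Qed.

Lemma mark_from_sub t lo v : mark_from n t lo v \subset block n t lo.
Proof.
elim: t lo v => [|l IHl r IHr] lo [|g v]; rewrite ?mark_from_root // ?sub0set //=.
by rewrite block_node; case: g; apply: subset_trans (_ : _ \subset _);
  [apply: IHr | apply: subsetUr | apply: IHl | apply: subsetUl].
Qed.

Lemma block_disjoint l r lo (x : 'I_n) :
  x \in block n l lo -> x \in block n r (lo + leaves l) -> False.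
Proof. by rewrite !inE; lia. Qed.

(** Justifies identifying vertices with intervals: the blocks of son and daughter are disjoint and
    non-empty, so no two vertices share an interval. *)
Lemma mark_from_inj t lo : lo + leaves t <= n ->
  {in vertices t &, injective (mark_from n t lo)}.
Proof.
elim: t lo => [|l IHl r IHr] lo le_n v w.
  by rewrite !inE => /eqP-> /eqP->.
have [l0 r0] := (leaves_gt0 l, leaves_gt0 r).
rewrite /= in le_n.
have lel : lo + leaves l <= n by clear -le_n; lia.
have ler : lo + leaves l + leaves r <= n by clear -le_n; lia.
have [x xl] := set0Pn _ (block_neq0 lel).
have [y yr] := set0Pn _ (block_neq0 ler).
have whole g v' : mark_from n (Node l r) lo (g :: v') <> block n (Node l r) lo.
  move=> /setP E; have /= := E x; have /= := E y.
  rewrite !block_node !in_setU xl yr !orbT; case: g {E} => /=.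
    by move=> _ /(subsetP (mark_from_sub _ _ _))/(block_disjoint xl).
  by move=> /(subsetP (mark_from_sub _ _ _))/block_disjoint/(_ yr).
have ne s o u : o + leaves s <= n -> u \in vertices s -> mark_from n s o u != set0.
  move=> so us; have [p [q [pq qn -> _ _]]] := mark_from_spec so us.
  have pn : p < n by clear -pq qn so; lia.
  by apply/set0Pn; exists (Ordinal pn); rewrite inE /=; clear -pq; lia.
case: v => [|g v]; case: w => [|h w] //.
- by move=> _ _ /esym; rewrite mark_from_root => /whole.
- by move=> _ _; rewrite mark_from_root => /whole.
rewrite !in_vertices_cons; case: g; case: h => /= vin win E.
- by congr (_ :: _); apply: (IHr _ ler).
- have [z zin] := set0Pn _ (ne _ _ _ ler vin).
  case: (@block_disjoint l r lo z); last exact: (subsetP (mark_from_sub _ _ _) _ zin).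
  by apply: (subsetP (mark_from_sub _ _ w)); rewrite -E.
- have [z zin] := set0Pn _ (ne _ _ _ lel vin).
  case: (@block_disjoint l r lo z); first exact: (subsetP (mark_from_sub _ _ _) _ zin).
  by apply: (subsetP (mark_from_sub _ _ w)); rewrite -E.
by congr (_ :: _); apply: (IHl _ lel).
Qed.

(** The vertices containing a given point form a chain, and [w] cannot lie strictly below [v]
    because [M] fits in neither child. The children of a leaf are marked [set0], so there the
    negated inclusions still say that [M] is non-empty. *)
Lemma mark_from_laminar t lo v w M : v \in vertices t -> w \in vertices t ->
  M \subset mark_from n t lo v -> M \subset mark_from n t lo w ->
  ~~ (M \subset mark_from n t lo (son v)) ->
  ~~ (M \subset mark_from n t lo (daughter v)) ->
  mark_from n t lo v \subset mark_from n t lo w.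
Proof.
elim: t lo v w => [|l IHl r IHr] lo v w.
  by rewrite !inE => /eqP-> /eqP->.
case: w => [|h w]; first by rewrite mark_from_root mark_from_sub.
case: v => [|g v].
  rewrite in_vertices_cons; case: h => /= _ _ _ s ns nd.
    case/negP: nd; rewrite /daughter /= mark_from_root.
    exact: subset_trans s (mark_from_sub _ _ _).
  case/negP: ns; rewrite /son /= mark_from_root.
  exact: subset_trans s (mark_from_sub _ _ _).
rewrite !in_vertices_cons; case: g; case: h => /= vin win sv sw ns nd.
- exact: IHr.
(* [ns] supplies a point of [M], which would lie in two disjoint blocks. *)
- case/subsetPn: ns => x xM _; case: (@block_disjoint l r lo x).
    by apply: (subsetP (mark_from_sub l lo w)); apply: (subsetP sw).
  by apply: (subsetP (mark_from_sub _ _ v)); apply: (subsetP sv).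
- case/subsetPn: ns => x xM _; case: (@block_disjoint l r lo x).
    by apply: (subsetP (mark_from_sub l lo v)); apply: (subsetP sv).
  by apply: (subsetP (mark_from_sub _ _ w)); apply: (subsetP sw).
exact: IHl.
Qed.

End Mark.

(** * Good maps as the transformations [alpha] *)

Section AlphaGood.
Variables (n : nat) (G : fbtree).
Hypothesis Gn : leaves G = n.

(** Links a vertex, given by its path, to the subtree and first leaf in terms of which [good] is
    stated. The last clause lets the relation pass to children. *)
Definition placed (v : vertex) (t : fbtree) (lo : nat) : Prop :=
  [/\ v \in vertices G, subtree G v = t, lo + leaves t <= n &
      forall w, mark n G (v ++ w) = mark_from n t lo w].

Lemma placed_root : placed [::] G 0.
Proof. by split; rewrite ?root_in_vertices ?subtree0 ?add0n ?Gn. Qed.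

Lemma placed_mark v t lo : placed v t lo -> mark n G v = block n t lo.
Proof. by case=> _ _ _ /(_ [::]); rewrite cats0 mark_from_root. Qed.

Lemma placed_son v l r lo : placed v (Node l r) lo -> placed (son v) l lo.
Proof.
rewrite /son -cats1 => -[vG vt le_n vm]; split=> [||| w].
- by rewrite vertices_cat // vt in_vertices_cons root_in_vertices.
- by rewrite subtree_cat // vt /= subtree0.
- by move: le_n => /=; lia.
- by rewrite -catA vm.
Qed.

Lemma placed_daughter v l r lo :
  placed v (Node l r) lo -> placed (daughter v) r (lo + leaves l).
Proof.
rewrite /daughter -cats1 => -[vG vt le_n vm]; split=> [||| w].
- by rewrite vertices_cat // vt in_vertices_cons root_in_vertices.
- by rewrite subtree_cat // vt /= subtree0.
- by move: le_n => /=; lia.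
- by rewrite -catA vm.
Qed.

Lemma set_child_mark c v : v \in vertices G ->
  set_child G c (mark n G v) = mark n G (c v).
Proof.
move=> vG; rewrite /set_child.
have inj := @mark_from_inj n G 0; rewrite Gn leqnn in inj.
case E: [seq _ <- _ | _] => [|w s].
  have : v \in [seq w <- vertices G | mark n G w == mark n G v].
    by rewrite mem_filter eqxx.
  by rewrite E.
have : w \in [seq w <- vertices G | mark n G w == mark n G v].
  by rewrite E mem_head.
by rewrite mem_filter => /andP[/eqP wv wG]; rewrite (inj isT w v).
Qed.

(** The interval of [v] is one of those intersected and, by laminarity, is contained in all the
    others. *)
Lemma hull_placed v l r lo (M : {set 'I_n}) : placed v (Node l r) lo ->
  M \subset block n (Node l r) lo -> ~~ (M \subset block n l lo) ->
  ~~ (M \subset block n r (lo + leaves l)) -> hull G M = mark n G v.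
Proof.
move=> pv sM nl nr; have vG : v \in vertices G by case: pv.
have vM := placed_mark pv.
rewrite -(placed_mark (placed_son pv)) in nl.
rewrite -(placed_mark (placed_daughter pv)) in nr.
rewrite /hull; apply/eqP; rewrite eqEsubset; apply/andP; split.
  rewrite (big_rem v vG) /= vM sM; exact: subsetIl.
rewrite big_seq_cond; apply: (big_ind (fun A : {set 'I_n} => mark n G v \subset A)).
- exact: subsetT.
- by move=> A B sA sB; rewrite subsetI sA.
move=> w /andP[wG sw]; rewrite -vM in sM.
exact: (@mark_from_laminar n G 0 v w M).
Qed.

(** Constant maps and splits match rules (b) and (c). A descent in the target changes nothing: the
    target tree does not occur in [alpha], which finds the hull of the image by itself. *)
Lemma alpha_good (f : 'I_n -> 'I_n) a t lo b u lo' :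
  placed a t lo -> placed b u lo' -> good f t lo u lo' ->
  alpha G (block n t lo) (f @: block n t lo) =
  [ffun x => if x \in block n t lo then Some (f x) else None].
Proof.
move=> pa pb gf; elim: gf a b pa pb => {t lo u lo'} [t lo lo' fE |
  t lo ul ur lo' _ IH | t lo ul ur lo' _ IH |
  tl tr lo ul ur lo' gl IHl gr IHr] a b pa pb.
- have le_n : lo + leaves t <= n by case: pa.
  have [x0 x0t] := set0Pn _ (block_neq0 le_n).
  have E : f @: block n t lo = [set f x0].
    apply/setP => y; rewrite inE; apply/imsetP/eqP => [[x xt ->]|->]; last by exists x0.
    by apply/val_inj; rewrite /= !fE.
  rewrite alphaE // (negPf (block_neq0 le_n)); case: pickP => [m|/(_ (f x0))]; last first.
    by rewrite E eqxx.
  rewrite E => /eqP/set1_inj <-; apply/ffunP => x; rewrite !ffunE.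
  by case: ifP => // xt; congr Some; apply/val_inj; rewrite /= !fE.
- exact: IH pa (placed_son pb).
- exact: IH pa (placed_daughter pb).
have le_n : lo + leaves (Node tl tr) <= n by case: pa.
have lel : lo + leaves tl <= n by case: (placed_son pa).
have ler : lo + leaves tl + leaves tr <= n by case: (placed_daughter pa).
have [x xl] := set0Pn _ (block_neq0 lel).
have [y yr] := set0Pn _ (block_neq0 ler).
have fxl := good_range gl xl; have fyr := good_range gr yr.
have fxM : f x \in f @: block n (Node tl tr) lo by rewrite imset_f // block_node inE xl.
have fyM : f y \in f @: block n (Node tl tr) lo.
  by rewrite imset_f // block_node inE yr orbT.
rewrite alphaE // (negPf (block_neq0 le_n)).
set M := f @: _ in fxM fyM *.
case: pickP => [m /eqP E|_].
  move: fxM fyM; rewrite E !inE => /eqP E1 /eqP E2.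
  by case: (@block_disjoint n ul ur lo' (f x)); rewrite // E1 -E2.
have EM : M = f @: block n tl lo :|: f @: block n tr (lo + leaves tl).
  by rewrite /M block_node imsetU.
have sl : f @: block n tl lo \subset block n ul lo'.
  by apply/subsetP => _ /imsetP[z zt ->]; apply: good_range gl _ zt.
have sr : f @: block n tr (lo + leaves tl) \subset block n ur (lo' + leaves ul).
  by apply/subsetP => _ /imsetP[z zt ->]; apply: good_range gr _ zt.
(* [f x] and [f y] lie under different children of [b], so neither child contains [M]. *)
have HM : hull G M = mark n G b.
  apply: (hull_placed pb).
  - by rewrite EM block_node setUSS.
  - apply/subsetPn; exists (f y) => //; apply/negP => fyl; exact: block_disjoint fyl fyr.
  - apply/subsetPn; exists (f x) => //; apply/negP => fxr; exact: block_disjoint fxl fxr.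
have aG : a \in vertices G by case: pa.
have bG : b \in vertices G by case: pb.
rewrite HM -(placed_mark pa) /set_son /set_daughter !set_child_mark //.
rewrite (placed_mark (placed_son pa)) (placed_mark (placed_daughter pa)).
rewrite (placed_mark (placed_son pb)) (placed_mark (placed_daughter pb)).
have -> : M :&: block n ul lo' = f @: block n tl lo.
  rewrite EM setIUl (setIidPl sl); apply/setUidPl/subsetP => z /setIP[/(subsetP sr) zr zl].
  by case: (block_disjoint zl zr).
have -> : M :&: block n ur (lo' + leaves ul) = f @: block n tr (lo + leaves tl).
  rewrite EM setIUl (setIidPl sr); apply/setUidPr/subsetP => z /setIP[/(subsetP sl) zl zr].
  by case: (block_disjoint zl zr).
rewrite (IHl _ _ (placed_son pa) (placed_son pb)).
rewrite (IHr _ _ (placed_daughter pa) (placed_daughter pb)).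
rewrite (placed_mark pa) block_node; apply/ffunP => z; rewrite !ffunE in_setU.
by case: (z \in block n tl lo).
Qed.

Lemma block_root : block n G 0 = setT.
Proof. by apply/setP => x; rewrite !inE /= Gn ltn_ord. Qed.

(** A good map from the root to the root is recovered from its image; this gives uniqueness within
    an L-class. *)
Lemma alpha_good_root (f : On n) :
  good f G 0 G 0 -> alpha G setT [set f x | x : 'I_n] = ptrans_of f.
Proof.
move=> gf; have := alpha_good placed_root placed_root gf; rewrite block_root.
rewrite imset_setT => ->; apply/ffunP => x.
by rewrite !ffunE inE.
Qed.

End AlphaGood.

(** * The cross-section of a self-similar tree *)

Section TreeCrossSection.
Variable n : nat.
Implicit Types (G : fbtree) (M : {set 'I_n}).

Lemma good_On_exists G M : leaves G = n -> self_similar G -> M != set0 ->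
  exists2 f : On n, good f G 0 G 0 & [set f x | x : 'I_n] = M.
Proof.
move=> Gn ssG M0; have BT := block_root Gn.
have [||f gf fM] := @good_exists n G 0 G 0 M ssG (embeds_refl G) _ M0.
- by rewrite Gn.
- by rewrite BT subsetT.
have op : order_preserving [ffun x => f x].
  apply/order_preservingP => x y xy; rewrite !ffunE.
  by apply: (good_mono gf); rewrite // BT inE.
exists (MkOn op); first by apply: eq_good gf => x _; rewrite ffunE.
by rewrite -fM BT imset_setT; apply: eq_imset => x; rewrite ffunE.
Qed.

Lemma ptrans_of_inj : injective (@ptrans_of n).
Proof.
move=> f g /ffunP E; apply/val_inj/ffunP => x.
by have := E x; rewrite !ffunE => -[].
Qed.

Lemma good_On_inj G (f g : On n) : leaves G = n -> good f G 0 G 0 ->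
  good g G 0 G 0 -> [set f x | x : 'I_n] = [set g x | x : 'I_n] -> f = g.
Proof.
move=> Gn gf gg E; apply: ptrans_of_inj.
by rewrite -(alpha_good_root Gn gf) E (alpha_good_root Gn gg).
Qed.

Lemma in_L_of_tree G (f : On n) : leaves G = n -> self_similar G ->
  ptrans_of f \in L_of_tree n G <-> good f G 0 G 0.
Proof.
move=> Gn ssG; split=> [/imsetP[M] | gf].
  rewrite inE => M0 E; have [g gg gM] := good_On_exists Gn ssG M0.
  by rewrite -gM (alpha_good_root Gn gg) in E; rewrite (ptrans_of_inj E).
apply/imsetP; exists [set f x | x : 'I_n]; last by rewrite (alpha_good_root Gn gf).
rewrite inE; have n0 : 0 < n by rewrite -Gn leaves_gt0.
by apply/set0Pn; exists (f (Ordinal n0)); apply: imset_f.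
Qed.

Lemma L_of_tree_good G : leaves G = n -> self_similar G ->
  L_of_tree n G = [set ptrans_of f | f in [set f : On n | ptrans_of f \in L_of_tree n G]].
Proof.
move=> Gn ssG; apply/setP => p; apply/idP/imsetP => [|[f]]; last first.
  by rewrite inE => ? ->.
move=> pL; have /imsetP[M] := pL; rewrite inE => M0 E.
have [g gg gM] := good_On_exists Gn ssG M0.
rewrite -gM (alpha_good_root Gn gg) in E.
by exists g; rewrite // inE -E.
Qed.

Lemma L_of_tree_cross_section G : leaves G = n -> self_similar G ->
  is_L_cross_section_On (L_of_tree n G).
Proof.
move=> Gn ssG; exists [set f : On n | ptrans_of f \in L_of_tree n G]; last first.
  exact: L_of_tree_good.
split=> [f g | a].
  rewrite !inE !in_L_of_tree // => gf gg.
  by apply: eq_good (good_comp gf gg) => x _; rewrite On_mulE.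
have n0 : 0 < n by rewrite -Gn leaves_gt0.
have [|f gf fM] := @good_On_exists G [set a x | x : 'I_n] Gn ssG.
  by apply/set0Pn; exists (a (Ordinal n0)); apply: imset_f.
exists f; split=> [|g [gC /green_L_On gL]].
  by split; [rewrite inE in_L_of_tree | apply/green_L_On].
rewrite inE in_L_of_tree // in gC.
by apply: (good_On_inj Gn gf gC); rewrite fM gL.
Qed.

End TreeCrossSection.

(** * From a cross-section, read through images, to a tree *)

Section CrossSectionTree.
Variables (n : nat) (C : {set On n}).
Implicit Types (e f g : On n) (A B : {set 'I_n}) (t : fbtree) (lo : nat).
Hypothesis CM : {in C &, forall f g, f * g \in C}.
Hypothesis C_inj : {in C &, forall f g,
  [set f x | x : 'I_n] = [set g x | x : 'I_n] -> f = g}.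
Hypothesis C_onto : forall A, A != set0 ->
  exists2 f, f \in C & [set f x | x : 'I_n] = A.

Definition local e A :=
  (forall x, x \notin A -> e x = x) /\ {in A, forall x, e x \in A}.

Lemma localW e A B : A \subset B -> local e A -> local e B.
Proof.
move=> /subsetP sAB [e_out e_in]; split=> [x xB | x xB].
  by apply/e_out/(contra (sAB x)).
by have [/e_in/sAB | /e_out->] := boolP (x \in A).
Qed.

(** [C_onto] prescribes only the image of a map; on a stable set this forces the map to be the
    identity outside [A]. The whole chain is stable, and [stable_tree] passes the property to both
    sides of a cut. *)
Definition stable A := forall f, f \in C ->
  (forall x, x \notin A -> exists y, f y = x) -> (exists y, f y \in A) -> local f A.

Lemma stable_exists A B : stable A -> B != set0 -> B \subset A ->
  exists2 e, e \in C & [/\ local e A, {in A, forall x, e x \in B} &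
    {in B, forall y, exists2 x, x \in A & e x = y}].
Proof.
move=> stA /set0Pn[b bB] /subsetP sBA.
have [|e eC eM] := C_onto (A := ~: A :|: B).
  by apply/set0Pn; exists b; rewrite inE bB orbT.
have im y : y \in ~: A :|: B -> exists x, e x = y.
  by rewrite -eM => /imsetP[x _ ->]; exists x.
have le : local e A.
  apply: stA => // [x xA|]; first by apply: im; rewrite !inE xA.
  by have [|x ex] := im b; [rewrite inE bB orbT | exists x; rewrite ex sBA].
exists e => //; split=> // [x xA | y yB].
  have : e x \in ~: A :|: B by rewrite -eM imset_f.
  by rewrite !inE (le.2 _ xA).
have [|x ex] := im y; first by rewrite inE yB orbT.
exists x => //; apply: contraT => xA.
by move: (xA); rewrite -(le.1 _ xA) ex (sBA _ yB).
Qed.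

(** The collapses that [family_good] needs at each node. The first detects the cut between the
    children; the other two shrink one child to an end of the interval while fixing its sister or
    brother pointwise. *)
Fixpoint adapted t lo : Prop :=
  if t is Node l r then
    [/\ exists2 e, e \in C & [/\ local e (block n t lo),
          {in block n l lo, forall x, e x = lo :> nat} &
          {in block n r (lo + leaves l), forall x, e x = (lo + leaves t).-1 :> nat}],
        exists2 e, e \in C & local e (block n l lo) /\
          {in block n l lo, forall x, e x = lo :> nat},
        exists2 e, e \in C & local e (block n r (lo + leaves l)) /\
          {in block n r (lo + leaves l), forall x, e x = (lo + leaves t).-1 :> nat},
        adapted l lo & adapted r (lo + leaves l)]
  else True.

(** If [x < f x], a preimage [z] of [x] in [A] satisfies [z < x = f z], a smaller counterexample.
    The case [f x < x] is dual, by induction from the top. *)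
Lemma mono_onto_id f A : {in A, forall y, exists2 x, x \in A & f x = y} ->
  {in A, forall x, f x = x}.
Proof.
move=> onto.
have le k (x : 'I_n) : x \in A -> x < k -> f x <= x.
  elim: k x => // k IH x xA; rewrite ltnS => xk; rewrite leqNgt; apply/negP => lt.
  have [z zA fz] := onto x xA.
  have zx : z < x.
    by rewrite ltnNge; apply/negP => /(On_mono f); rewrite fz leqNgt lt.
  by have := IH z zA (leq_trans zx xk); rewrite fz leqNgt zx.
have ge k (x : 'I_n) : x \in A -> n - x < k -> x <= f x.
  elim: k x => // k IH x xA; rewrite ltnS => xk; rewrite leqNgt; apply/negP => lt.
  have [z zA fz] := onto x xA.
  have xz : x < z.
    by rewrite ltnNge; apply/negP => /(On_mono f); rewrite fz leqNgt lt.
  have zn := ltn_ord z.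
  have zk : n - z < k by clear -xk xz zn; lia.
  by have := IH z zA zk; rewrite fz leqNgt xz.
move=> x xA; apply/val_inj/eqP; rewrite eqn_leq.
by rewrite (le x.+1) // (ge (n - x).+1).
Qed.

(** A [block] given by its length, for use before its tree is built. *)
Definition seg lo k : {set 'I_n} := [set x : 'I_n | lo <= x < lo + k].

(** Strong induction on [k]. A map in [C] that reaches everything outside one half, and meets that
    half, preserves the cut; it then maps the other half onto itself and is the identity there.
    Hence both halves are stable again. *)
Lemma stable_tree lo k : 0 < k -> lo + k <= n -> stable (seg lo k) ->
  exists2 t, leaves t = k & adapted t lo.
Proof.
have [N] := ubnP k; elim: N k lo => // N IH k lo; rewrite ltnS => kN k0 le_n st.
have [k1 | k1] := leqP k 1; first by exists Leaf => //=; lia.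
set A := seg lo k in st.
have lo_n : lo < n by lia.
have hi_n : (lo + k).-1 < n by lia.
pose p := Ordinal lo_n; pose q := Ordinal hi_n.
have pA : p \in A by rewrite inE /=; lia.
have qA : q \in A by rewrite inE /=; lia.
have inA (x : 'I_n) : x \in A -> p <= x <= q by rewrite inE /=; lia.
have [||e eC [le eM eonto]] := @stable_exists A [set p; q] st.
- by apply/set0Pn; exists p; rewrite !inE eqxx.
- by apply/subsetP => x; rewrite !inE => /orP[] /eqP-> /=; lia.
have ep : e p = p.
  have [|x xA ex] := eonto p; first by rewrite !inE eqxx.
  have := On_mono e (proj1 (andP (inA _ xA))); rewrite ex => le1.
  have /andP[le2 _] := inA _ (le.2 _ pA).
  by apply/val_inj/eqP; rewrite eqn_leq le1 le2.
have eq_q : e q = q.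
  have [|x xA ex] := eonto q; first by rewrite !inE eqxx orbT.
  have := On_mono e (proj2 (andP (inA _ xA))); rewrite ex => le1.
  have /andP[_ le2] := inA _ (le.2 _ qA).
  by apply/val_inj/eqP; rewrite eqn_leq le1 le2.
have pq : p != q by rewrite -val_eqE /=; lia.
(* [m] is the least point of the upper fibre of [e]; the daughter starts there. *)
have [m em mmin] : exists2 m, e m = q & forall x, e x = q -> m <= x.
  case: (@arg_minnP _ q (fun x => e x == q) val) => [|m /eqP em mmin].
    by rewrite eq_q.
  by exists m => // x /eqP/mmin.
have pm : p < m.
  by rewrite ltnNge; apply/negP => /(On_mono e); rewrite em ep /=; lia.
have mq : m <= q by apply: mmin.
have mA : m \in A by rewrite inE; move: pm mq => /=; lia.
have eE x : x \in A -> e x = if x < m then p else q.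
  move=> xA; have := eM _ xA; rewrite !inE.
  case: ltnP => xm; last first.
    case/orP => [/eqP E|/eqP//].
    by have := On_mono e xm; rewrite em E /=; lia.
  by case/orP => /eqP // /mmin; rewrite leqNgt xm.
have cutP f : f \in C -> (forall x, x \notin A -> exists y, f y = x) ->
    (exists y, f y \in A /\ f y < m) -> (exists y, f y \in A /\ m <= f y) ->
    local f A /\ {in A, forall x, (f x < m) = (x < m)}.
  move=> fC f_out [y [yA ym]] [z [zA zm]].
  have lf : local f A by apply: st => //; exists y.
  split=> // x xA.
  suff fe : f * e = e.
    have := eE _ (lf.2 _ xA); rewrite -On_mulE fe eE //.
    by do 2 case: ifP => // _; move=> E; move: pq; rewrite E eqxx.
  (* The images agree: [f] is the identity outside [A], and its values at [y] and [z] meet both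
     fibres of [e] in [A]. *)
  apply: C_inj; rewrite ?CM //; apply/setP => w; apply/imsetP/imsetP.
    by case=> u _ ->; exists (f u); rewrite // On_mulE.
  case=> u _ ->; have [uA|uA] := boolP (u \in A); last first.
    by exists u; rewrite // On_mulE (lf.1 _ uA).
  rewrite eE //; case: ifP => _; [exists y | exists z] => //.
    by rewrite On_mulE eE // ym.
  by rewrite On_mulE eE // ltnNge zm.
pose kl := m - lo; pose kr := lo + k - m.
have lol : lo + kl = m by rewrite /kl; move: pm => /=; clear; lia.
have lor : m + kr = lo + k by rewrite /kr; move: mq => /=; clear -k0; lia.
have inl x : x \in seg lo kl = (x \in A) && (x < m).
  by rewrite !inE lol; move: mq => /=; clear -k0; lia.
have inr x : x \in seg m kr = (x \in A) && (m <= x).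
  by rewrite !inE lor; move: pm => /=; clear; lia.
have splitl f : f \in C -> (forall x, x \notin seg lo kl -> exists y, f y = x) ->
    (exists y, f y \in seg lo kl) ->
    local f A /\ {in A, forall x, (f x < m) = (x < m)}.
  move=> fC f_out [y]; rewrite inl => /andP[yA ym].
  apply: cutP => //; last 1 first.
  (* The second fibre is met because [m], lying in the other half, is a value of [f]; [p] plays this
     part in [splitr]. *)
  - have [|z fz] := f_out m; first by rewrite inl ltnn andbF.
    by exists z; rewrite fz mA.
  - by move=> x xA; apply: f_out; rewrite inl (negPf xA).
  by exists y.
have splitr f : f \in C -> (forall x, x \notin seg m kr -> exists y, f y = x) ->
    (exists y, f y \in seg m kr) ->
    local f A /\ {in A, forall x, (f x < m) = (x < m)}.
  move=> fC f_out [y]; rewrite inr => /andP[yA ym].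
  apply: cutP => //; last 1 first.
  - by exists y.
  - by move=> x xA; apply: f_out; rewrite inr (negPf xA).
  have [|z fz] := f_out p; first by rewrite inr leqNgt pm andbF.
  by exists z; rewrite fz pA.
have stl : stable (seg lo kl).
  move=> f fC f_out f_in; have [lf fm] := splitl f fC f_out f_in.
  split=> x; rewrite inl; last first.
    by case/andP=> xA xm; rewrite inl fm // xm lf.2.
  rewrite negb_and -leqNgt; have [xA /= mx|/lf.1//] := boolP (x \in A).
  (* Since [f] preserves the cut and fixes the complement of [A], preimages of points of the upper
     half lie in the upper half. *)
  apply: (@mono_onto_id f (seg m kr)); last by rewrite inr xA.
  move=> y; rewrite inr => /andP[yA my].
  have [|z fz] := f_out y; first by rewrite inl ltnNge my andbF.
  exists z => //; have zA : z \in A.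
    by apply: contraT => zA; move: (zA); rewrite -(lf.1 _ zA) fz yA.
  by rewrite inr zA leqNgt -fm // fz -leqNgt.
have str : stable (seg m kr).
  move=> f fC f_out f_in; have [lf fm] := splitr f fC f_out f_in.
  split=> x; rewrite inr; last first.
    by case/andP=> xA xm; rewrite inr leqNgt fm // -leqNgt xm lf.2.
  rewrite negb_and -ltnNge; have [xA /= mx|/lf.1//] := boolP (x \in A).
  apply: (@mono_onto_id f (seg lo kl)); last by rewrite inl xA.
  move=> y; rewrite inl => /andP[yA my].
  have [|z fz] := f_out y; first by rewrite inr leqNgt my andbF.
  exists z => //; have zA : z \in A.
    by apply: contraT => zA; move: (zA); rewrite -(lf.1 _ zA) fz yA.
  by rewrite inl zA -fm // fz.
have kl0 : 0 < kl by rewrite /kl; move: pm => /=; clear; lia.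
have kr0 : 0 < kr by rewrite /kr; move: mq => /=; clear -k1; lia.
have [|//||l ll al] := IH kl lo _ _ _ stl.
- by clear -lor lol kr0 kN; lia.
- by clear -lor lol le_n; lia.
have [|//||r lr ar] := IH kr m _ _ _ str.
- by clear -lor lol kl0 kN; lia.
- by clear -lor lol le_n; lia.
have BA : block n (Node l r) lo = A by rewrite /block /= ll lr /A /seg addnA lol lor.
have Bl : block n l lo = seg lo kl by rewrite /block ll.
have Br : block n r m = seg m kr by rewrite /block lr.
exists (Node l r); first by rewrite /= ll lr; clear -lol lor; lia.
rewrite /= -/(block n (Node l r) lo) addnA ll lol lr lor BA Bl Br; split=> //.
- exists e => //; split=> // x.
    by rewrite inl => /andP[xA xm]; rewrite eE // xm.
  by rewrite inr => /andP[xA xm]; rewrite eE // ltnNge xm.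
- have [||c cC [lc cM _]] := @stable_exists _ [set p] stl.
  + by apply/set0Pn; exists p; rewrite inE.
  + by rewrite sub1set inl pA pm.
  by exists c => //; split=> // x /cM/set1P->.
have [||c cC [lc cM _]] := @stable_exists _ [set q] str.
- by apply/set0Pn; exists q; rewrite inE.
- by rewrite sub1set inr qA mq.
by exists c => //; split=> // x /cM/set1P->.
Qed.

(* F starts as C itself. In passing to the sons of A and B it shrinks to those f that
   send the daughter of A to max B, so that f on A is still determined by the image of
   the son of A; dually for the daughters. *)
Lemma family_good tA lo tB lo' (F : On n -> Prop) :
  lo + leaves tA <= n -> adapted tA lo -> adapted tB lo' ->
  (forall f g, F f -> F g -> f @: block n tA lo = g @: block n tA lo ->
     {in block n tA lo, f =1 g}) ->
  (forall e f, e \in C -> local e (block n tA lo) -> F f -> F (e * f)) ->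
  (forall f e, e \in C -> local e (block n tB lo') -> F f -> F (f * e)) ->
  forall f, F f -> {in block n tA lo, forall x, f x \in block n tB lo'} ->
  good f tA lo tB lo'.
Proof.
elim: tB tA lo lo' F => [|ul IHl ur IHr] tA lo lo' F le_n adA adB F_inj FL FR f Ff fAB.
  by apply: good_leaf => x /fAB; rewrite inE /=; lia.
have [adul adur] : adapted ul lo' /\ adapted ur (lo' + leaves ul) by case: adB.
have subl : block n ul lo' \subset block n (Node ul ur) lo' by rewrite block_node subsetUl.
have subr : block n ur (lo' + leaves ul) \subset block n (Node ul ur) lo'.
  by rewrite block_node subsetUr.
have [/forall_inP fl | /forall_inPn[y yA fyl]] :=
    boolP [forall x in block n tA lo, f x \in block n ul lo'].
  by apply: good_left; apply: (IHl tA lo lo' F) => // g e eC /(localW subl); apply: FR.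
have [/forall_inP fr | /forall_inPn[x xA fxr]] :=
    boolP [forall x in block n tA lo, f x \in block n ur (lo' + leaves ul)].
  by apply: good_right; apply: (IHr tA lo _ F) => // g e eC /(localW subr); apply: FR.
have {fyl} fyr : f y \in block n ur (lo' + leaves ul).
  by have := fAB y yA; rewrite block_node inE (negPf fyl).
have {fxr} fxl : f x \in block n ul lo'.
  by have := fAB x xA; rewrite block_node inE (negPf fxr) orbF.
(* A one-point domain cannot meet both children of the target. *)
case: tA le_n adA F_inj FL fAB xA yA => [|tl tr] le_n adA F_inj FL fAB xA yA.
  have xy : x = y by apply/val_inj; move: xA yA; rewrite !inE /=; lia.
  by rewrite xy in fxl; case: (block_disjoint fxl fyr).
case: adA => -[eA eAC [leA eAl eAr]] _ _ adtl adtr.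
case: adB => -[eB eBC [leB eBl eBr]] [cl clC [lcl clE]] [cr crC [lcr crE]] _ _.
have [l0 r0] := (leaves_gt0 tl, leaves_gt0 tr).
have [ul0 ur0] := (leaves_gt0 ul, leaves_gt0 ur).
have inA z : z \in block n (Node tl tr) lo -> lo <= z <= (lo + leaves (Node tl tr)).-1.
  by rewrite inE; clear; lia.
(* [eA z] is the least point of the domain, hence at most [x], and [f x] is in the lower block. *)
have cutl z : z \in block n tl lo -> f (eA z) \in block n ul lo'.
  move=> zl; have ez : eA z <= x by rewrite eAl //; case/andP: (inA _ xA).
  have zA : z \in block n (Node tl tr) lo by rewrite block_node inE zl.
  have := fAB _ (leA.2 _ zA); have := On_mono f ez;
    move: fxl; clear; rewrite !inE /=; lia.
have cutr z : z \in block n tr (lo + leaves tl) -> f (eA z) \in block n ur (lo' + leaves ul).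
  move=> zr; have ez : y <= eA z by rewrite eAr //; case/andP: (inA _ yA).
  have zA : z \in block n (Node tl tr) lo by rewrite block_node inE zr orbT.
  have := fAB _ (leA.2 _ zA); have := On_mono f ez;
    move: fyr; clear; rewrite !inE /=; lia.
have le_l : lo + leaves tl <= n by move: le_n; clear; rewrite /=; lia.
have le_r : lo + leaves tl + leaves tr <= n by move: le_n; clear; rewrite /=; lia.
have [x0 x0l] := set0Pn _ (block_neq0 le_l).
have [y0 y0r] := set0Pn _ (block_neq0 le_r).
have FfB : F (f * eB) by apply: FR.
have FAfB : F (eA * (f * eB)) by apply: FL.
(* On the domain both maps have the two ends of the target interval as image, so [F_inj] identifies
   them. Comparing their values at [z] shows that [f] carries the cut of the domain to the cut of
   the target. *)
have gE : {in block n (Node tl tr) lo, eA * (f * eB) =1 f * eB}.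
  apply: F_inj => //; apply/setP => w; apply/imsetP/imsetP => -[z zA ->].
    by exists (eA z); rewrite ?leA.2 // !On_mulE.
  rewrite !On_mulE; have := fAB z zA; rewrite block_node inE => /orP[fz|fz].
    exists x0; first by rewrite block_node inE x0l.
    by apply/val_inj; rewrite !On_mulE /= !eBl // cutl.
  exists y0; first by rewrite block_node inE y0r orbT.
  by apply/val_inj; rewrite !On_mulE /= !eBr // cutr.
have fl : {in block n tl lo, forall z, f z \in block n ul lo'}.
  move=> z zl; have zA : z \in block n (Node tl tr) lo by rewrite block_node inE zl.
  have := fAB z zA; rewrite block_node inE => /orP[//|fz].
  have := congr1 val (gE z zA);
    rewrite !On_mulE /= eBl ?cutl // eBr //=; clear -ul0 ur0; lia.
have fr : {in block n tr (lo + leaves tl), forall z, f z \in block n ur (lo' + leaves ul)}.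
  move=> z zr; have zA : z \in block n (Node tl tr) lo by rewrite block_node inE zr orbT.
  have := fAB z zA; rewrite block_node inE => /orP[fz|//].
  have := congr1 val (gE z zA);
    rewrite !On_mulE /= eBr ?cutr // eBl //=; clear -ul0 ur0; lia.
have subtl : block n tl lo \subset block n (Node tl tr) lo by rewrite block_node subsetUl.
have subtr : block n tr (lo + leaves tl) \subset block n (Node tl tr) lo.
  by rewrite block_node subsetUr.
apply: good_split.
  (* [cr] moves only points of the daughter of the target, so [f * cr] agrees with [f] on [tl];
     being constant on [tr], it belongs to the smaller family. *)
  apply: (@eq_good n (f * cr)).
    move=> z zl; rewrite On_mulE lcr.1 //; apply/negP => fz.
    exact: block_disjoint (fl _ zl) fz.
  apply: (IHl tl lo lo' (fun h => F h /\ {in block n tr (lo + leaves tl),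
    forall z, h z = (lo' + leaves (Node ul ur)).-1 :> nat})) => //.
  - move=> g h [Fg gr] [Fh hr] E z zl; apply: F_inj => //; last exact: (subsetP subtl).
    rewrite block_node !imsetU E; congr (_ :|: _); apply: eq_in_imset => w wr.
    by apply/val_inj; rewrite /= gr // hr.
  - move=> e h eC le [Fh hr]; split=> [|z zr]; first by apply: FL => //; apply: localW le.
    rewrite On_mulE le.1 ?hr //; apply/negP => zl; exact: block_disjoint zl zr.
  (* The constant value on [tr] is the last point of the target, outside the block of [ul], so [e]
     fixes it. *)
  - move=> h e eC le [Fh hr]; split=> [|z zr]; first by apply: FR => //; apply: localW le.
    by rewrite On_mulE le.1 ?hr // inE hr //=; clear -ur0; lia.
  - split=> [|z zr]; first by apply: FR => //; apply: localW lcr.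
    by rewrite On_mulE crE // fr.
  move=> z zl; rewrite On_mulE lcr.1 ?fl //; apply/negP => fz.
  exact: block_disjoint (fl _ zl) fz.
apply: (@eq_good n (f * cl)).
  move=> z zr; rewrite On_mulE lcl.1 //; apply/negP => fz.
  exact: block_disjoint fz (fr _ zr).
apply: (IHr tr (lo + leaves tl) (lo' + leaves ul) (fun h => F h /\ {in block n tl lo,
  forall z, h z = lo' :> nat})) => //.
- move=> g h [Fg gr] [Fh hr] E z zl; apply: F_inj => //; last exact: (subsetP subtr).
  rewrite block_node !imsetU E; congr (_ :|: _); apply: eq_in_imset => w wr.
  by apply/val_inj; rewrite /= gr // hr.
- move=> e h eC le [Fh hr]; split=> [|z zr]; first by apply: FL => //; apply: localW le.
  rewrite On_mulE le.1 ?hr //; apply/negP => zl; exact: block_disjoint zr zl.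
- move=> h e eC le [Fh hr]; split=> [|z zr]; first by apply: FR => //; apply: localW le.
  by rewrite On_mulE le.1 ?hr // inE hr //=; clear -ul0; lia.
- split=> [|z zr]; first by apply: FR => //; apply: localW lcl.
  by rewrite On_mulE clE // fl.
move=> z zl; rewrite On_mulE lcl.1 ?fr //; apply/negP => fz.
exact: block_disjoint fz (fr _ zl).
Qed.

End CrossSectionTree.

(** * Assembling both directions *)

(** A self-similar tree for every number of leaves; through [good_On_exists] it shows that every
    non-empty set is the image of an order-preserving map, hence of an element of the
    cross-section. *)
Fixpoint right_comb k : fbtree := if k is k'.+1 then Node Leaf (right_comb k') else Leaf.

Lemma leaves_right_comb k : leaves (right_comb k) = k.+1.
Proof. by elim: k => //= k ->. Qed.

Lemma self_similar_right_comb k : self_similar (right_comb k).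
Proof.
suff H : self_similar (right_comb k) && embeds (right_comb k) (right_comb k.+1).
  by case/andP: H.
by elim: k => //= k /andP[-> /= ->].
Qed.

Lemma L_cross_section_tree n (C : {set On n}) : 0 < n -> L_cross_section C ->
  exists G, [/\ self_similar G, leaves G = n & {in C, forall f : On n, good f G 0 G 0}] /\
    (forall M : {set 'I_n}, M != set0 ->
       exists2 f, f \in C & [set f x | x : 'I_n] = M).
Proof.
move=> n0 [CM Cex].
have C_inj : {in C &, forall f g : On n,
    [set f x | x : 'I_n] = [set g x | x : 'I_n] -> f = g}.
  move=> f g fC gC E; have [h [_ huniq]] := Cex g.
  rewrite -(huniq f); last by split=> //; apply/green_L_On.
  by apply: huniq; split=> //; apply/green_L_On.
have C_onto (M : {set 'I_n}) : M != set0 ->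
    exists2 f, f \in C & [set f x | x : 'I_n] = M.
  move=> M0; have n1 : leaves (right_comb n.-1) = n by rewrite leaves_right_comb prednK.
  have [a _ aM] := good_On_exists n1 (self_similar_right_comb _) M0.
  by have [c [[cC /green_L_On cM] _]] := Cex a; exists c; rewrite ?cM.
(* The complement of the whole chain is empty, so the recursion can start. *)
have st : stable C (seg n 0 n).
  by move=> f _ _ _; split=> x; rewrite !inE /= ltn_ord.
have [G Gn adG] := stable_tree (lo := 0) CM C_inj C_onto n0 (leqnn n) st.
have BT := block_root Gn.
have Cgood : {in C, forall f : On n, good f G 0 G 0}.
  move=> f fC; apply: (family_good (F := fun f => f \in C) _ adG adG) => //.
  - by rewrite Gn.
  - move=> g h gC hC; rewrite BT !imset_setT => /C_inj-> //.
  - by move=> e g eC _ gC; apply: CM.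
  - by move=> e g eC _ gC; apply: CM.
  - by rewrite BT => x _; rewrite inE.
exists G; split=> //; split=> //.
apply: (@full_self_similar n G 0); first by rewrite Gn.
move=> M M0 _; have [f fC fM] := C_onto M M0; exists f; first exact: Cgood.
by rewrite -fM BT imset_setT.
Qed.

Theorem theorem5p7 (n : nat) (n_gt0 : 0 < n) :
  (forall G : fbtree, respectful G -> leaves G = n ->
     is_L_cross_section_On (L_of_tree n G)) /\
  (forall X : {set ptrans n}, is_L_cross_section_On X ->
     exists G : fbtree, [/\ respectful G, leaves G = n & X = L_of_tree n G]).
Proof.
split=> [G /respectful_self_similar ssG Gn | X [C CC ->]].
  exact: L_of_tree_cross_section.
have [G [[ssG Gn Cgood] C_onto]] := L_cross_section_tree n_gt0 CC.
exists G; split=> //; first exact: self_similar_respectful.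
apply/setP => p; apply/imsetP/imsetP => [[f fC ->] | [M]].
  by apply/imsetP; rewrite in_L_of_tree //; apply: Cgood.
(* The element of [C] with image [M] is good, so it is the transformation that [alpha] builds from
   [M]. *)
rewrite inE => M0 ->; have [f fC fM] := C_onto M M0.
by exists f; rewrite // -fM alpha_good_root //; apply: Cgood.
Qed.
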